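(* Let $u:V\to\mathbb{C}$ be such that $Wf:=u\cdot (f\circ \psi)$ defines a bounded weighted composition operator $W$ on $L^2(\mu)$. Then: (1) $W$ is $\ast$-paranormal if and only if for every $\lambda\ge 0$ the operator $$f\mapsto \big(h_2\cdot E_2(|u|_2^2)\circ \psi^{-2}\big) f-2 \lambda\, u\cdot (h_1\circ \psi) \cdot E_1(\bar{u}f) + \lambda^2 f$$ on $L^2(\mu)$ is positive (i.e. $\langle Af,f\rangle\ge 0$ for every $f\in L^2(\mu)$, where $A$ is this operator). (2) $W$ is quasi-$\ast$-paranormal if and only if for every $\lambda\ge 0$ the operator $$f\mapsto\Big(h_3\cdot E_3(|u|_3^2)\circ \psi^{-3} - 2\lambda \big(h_1\cdot E_1(|u|^2)\circ \psi^{-1}\big)^2+ \lambda^2\, h_1\cdot E_1(|u|^2)\circ\psi^{-1} \Big)f$$ on $L^2(\mu)$ is positive.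
   Context: Let $m\in\mathbb{N}$, $J_n=\{1,\dots,n\}$ (with $J_0=\emptyset$), and $\eta_r\in\mathbb{N}\cup\{0\}$ for $r\in J_m$, at least one $\eta_r$ being non-zero. $V=\{v_1,\dots,v_m\}\cup\bigcup_{r=1}^m\bigcup_{i=1}^{\eta_r}\{v^r_{i,j}:j\in\mathbb{N}\}$, all listed points being distinct; $V$ is viewed as a directed graph with one circuit $\{v_1,\dots,v_m\}$ and $\eta_r$ infinite branches attached at $v_r$. The map $\psi:V\to V$ is the parent map: $\psi(v_{r+1})=v_r$ for $1\le r<m$, $\psi(v_1)=v_m$, $\psi(v^r_{i,1})=v_r$, and $\psi(v^r_{i,j+1})=v^r_{i,j}$ for $r\in J_m$, $i\in J_{\eta_r}$, $j\in\mathbb{N}$. $\mu$ is a positive measure on $V$, with $\mathscr{V}$ the $\sigma$-algebra of all subsets, and with $0<\mu(\{v\})<\infty$ for every $v\in V$; $L^2(\mu)=L^2(V,\mathscr{V},\mu)$. For $n\in\mathbb{N}$, $h_n=\frac{d(\mu\circ\psi^{-n})}{d\mu}$, i.e. $h_n(v)=\mu(\psi^{-n}(\{v\}))/\mu(\{v\})$. $E_n$ is the conditional expectation with respect to $\psi^{-n}\mathscr{V}$: $E_n(g)$ is constant on each atom $\psi^{-n}(\{v\})$ of $\psi^{-n}\mathscr{V}$, equal there to $\frac{1}{\mu(\psi^{-n}(\{v\}))}\int_{\psi^{-n}(\{v\})} g\,d\mu$. $E_n(g)\circ\psi^{-n}$ denotes the function $F$ on $V$ with $F\circ\psi^n=E_n(g)$,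 i.e. $F(v)$ is the value of $E_n(g)$ on $\psi^{-n}(\{v\})$. $|u|_n^2=|u|^2\cdot|u\circ\psi|^2\cdots|u\circ\psi^{n-1}|^2$. A bounded operator $T$ on a Hilbert space $\mathcal{H}$ is $\ast$-paranormal if $\|T^*x\|^2\le\|T^2x\|\,\|x\|$ for all $x\in\mathcal{H}$, and quasi-$\ast$-paranormal if $\|T^*Tx\|^2\le\|T^3x\|\,\|Tx\|$ for all $x\in\mathcal{H}$. *)

(* Defs.v *)
From HB Require Import structures.
From mathcomp Require Import all_boot all_order all_algebra.
From mathcomp Require Import all_classical all_reals all_analysis.
From mathcomp Require Import complex.

Set Implicit Arguments.
Unset Strict Implicit.
Unset Printing Implicit Defensive.
Import Order.TTheory GRing.Theory Num.Theory.
Local Open Scope classical_set_scope.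
Local Open Scope complex_scope.
Local Open Scope ring_scope.

(* The circuit has m.+1 >= 1 vertices, and indices start from 0: [circuit r]
   is v_(r+1) and [branch r i j] is v^(r+1)_(i+1, j+1). *)
Inductive vertex (m : nat) (eta : 'I_m.+1 -> nat) : Type :=
| circuit of 'I_m.+1
| branch (r : 'I_m.+1) of 'I_(eta r) & nat.
Arguments circuit {m eta}.
Arguments branch {m eta} r.

Definition vertex_code (m : nat) (eta : 'I_m.+1 -> nat) (v : vertex eta) :
    'I_m.+1 + {r : 'I_m.+1 & ('I_(eta r) * nat)%type} :=
  match v with
  | circuit r => inl r
  | branch r i j => inr (existT _ r (i, j))
  end.

Definition vertex_decode (m : nat) (eta : 'I_m.+1 -> nat)
    (c : 'I_m.+1 + {r : 'I_m.+1 & ('I_(eta r) * nat)%type}) : vertex eta :=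
  match c with
  | inl r => circuit r
  | inr (existT r ij) => branch r ij.1 ij.2
  end.

Lemma vertex_codeK (m : nat) (eta : 'I_m.+1 -> nat) :
  cancel (@vertex_code m eta) (@vertex_decode m eta).
Proof. by case. Qed.

HB.instance Definition _ (m : nat) (eta : 'I_m.+1 -> nat) :=
  Countable.copy (vertex eta) (can_type (@vertex_codeK m eta)).
HB.instance Definition _ (m : nat) (eta : 'I_m.+1 -> nat) :=
  isPointed.Build (vertex eta) (circuit ord0).
HB.instance Definition _ (m : nat) (eta : 'I_m.+1 -> nat) :=
  @isMeasurable.Build default_measure_display
  (vertex eta) discrete_measurable discrete_measurable0
  discrete_measurableC discrete_measurableU.

(* The map psi: [ord_pred] sends 0 to m, that is v_1 to v_(m+1). *)
Definition parent (m : nat) (eta : 'I_m.+1 -> nat) (v : vertex eta) :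
    vertex eta :=
  match v with
  | circuit r => circuit (ord_pred r)
  | branch r _ 0 => circuit r
  | branch r i j.+1 => branch r i j
  end.

Section L2_operators.
Context (d : measure_display) (T : measurableType d) (R : realType).
Variable mu : {measure set T -> \bar R}.
Implicit Types (D : set T) (f g : T -> R[i]) (A B : (T -> R[i]) -> T -> R[i]).

Definition Cintegral D f : R[i] :=
  (\int[mu]_(x in D) complex.Re (f x)) +i* (\int[mu]_(x in D) complex.Im (f x)).

Definition eL2norm f : \bar R :=
  ('N[mu]_2%:E[EFin \o (fun x => complex.Re `|f x|%R)])%E.

(* Elements are functions, not classes modulo a.e. equality; the two agree
   when every singleton has positive measure. *)
Definition L2 : set (T -> R[i]) := [set f |
  [/\ measurable_fun setT (fun x => complex.Re (f x)),
      measurable_fun setT (fun x => complex.Im (f x)) & (eL2norm f < +oo)%E]].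

Definition L2norm f : R := fine (eL2norm f).

Definition L2inner f g : R[i] := Cintegral setT (fun x => f x * (g x)^*).

Definition bounded_operator A : Prop :=
  [/\ forall f, L2 f -> L2 (A f),
      forall (a : R[i]) f g, L2 f -> L2 g ->
        A (fun x => a * f x + g x) = (fun x => a * A f x + A g x)
    & exists M : R, forall f, L2 f -> L2norm (A f) <= M * L2norm f].

Definition is_adjoint A B : Prop := bounded_operator B /\
  forall f g, L2 f -> L2 g -> L2inner (A f) g = L2inner f (B g).

Definition star_paranormal A : Prop := exists2 B, is_adjoint A B &
  forall f, L2 f -> L2norm (B f) ^+ 2 <= L2norm (A (A f)) * L2norm f.

Definition quasi_star_paranormal A : Prop := exists2 B, is_adjoint A B &
  forall f, L2 f ->
    L2norm (B (A f)) ^+ 2 <= L2norm (A (A (A f))) * L2norm (A f).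

(* The order of R[i] makes [0 <= z] mean that z is real and nonnegative. *)
Definition positive_operator A : Prop := bounded_operator A /\
  forall f, L2 f -> 0 <= L2inner (A f) f.

End L2_operators.

Section weighted_composition.
Context (R : realType) (m : nat) (eta : 'I_m.+1 -> nat).
Variable mu : {measure set (vertex eta) -> \bar R}.
Local Notation V := (vertex eta).
Implicit Types (n : nat) (u g f : V -> R[i]) (v : V).

Definition wcomp u f : V -> R[i] := fun v => u v * f (parent v).

Definition atom n v : set V := iter n (@parent m eta) @^-1` [set v].

(* h_n = d(mu o psi^-n)/dmu, which on a countable space with all point masses
   positive is the quotient of the point masses. *)
Definition RNderiv n v : R := fine (mu (atom n v)) / fine (mu [set v]).

(* [condE_pull n g] is E_n(g) o psi^-n, the function on V whose composition
   with psi^n is E_n(g). *)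
Definition condE_pull n g : V -> R[i] := fun v =>
  Cintegral mu (atom n v) g / (fine (mu (atom n v)))%:C.

Definition condE n g : V -> R[i] := fun v =>
  condE_pull n g (iter n (@parent m eta) v).

(* |u|_n^2 *)
Definition sqnormn u n : V -> R[i] := fun v =>
  \prod_(k < n) `|u (iter k (@parent m eta) v)| ^+ 2.

End weighted_composition.

(* Main.v *)
(* W* is given by (W*g)(v) = h_1(v) E_1(conj(u) g)(psi^-1(v)), so that
   W*^n W^n is multiplication by h_n E_n(|u|_n^2) o psi^-n, and W W* and W*W are
   the operators appearing in the statement.  Both inequalities have the form
   |Yf|^2 <= |Xf| |Zf|, which by a discriminant argument means that
   <(X*X - 2 l Y*Y + l^2 Z*Z)f, f> = |Xf|^2 - 2 l |Yf|^2 + l^2 |Zf|^2 is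
   nonnegative for every l >= 0: take (X, Y, Z) = (W^2, W*, 1) for (1) and
   (W^3, W*W, W) for (2).  The fibres of psi^n are finite, so conditional
   expectations are finite weighted sums, and W* is bounded by Cauchy-Schwarz on
   each fibre. *)
Require Import Defs.
From HB Require Import structures.
From mathcomp Require Import all_boot all_order all_algebra.
From mathcomp Require Import all_classical all_reals all_analysis.
From mathcomp Require Import measurable_realfun.
From mathcomp Require Import complex ring lra.
Import Order.TTheory GRing.Theory Num.Theory.
Local Open Scope classical_set_scope.
Local Open Scope complex_scope.
Local Open Scope ring_scope.

Set Implicit Arguments.
Unset Strict Implicit.
Unset Printing Implicit Defensive.

(** * A discriminant criterion for quadratic polynomials on the half-line *)

Section discriminant.
Context (R : realFieldType).
Implicit Types a b c l : R.

(** One direction rewrites the quadratic as (a - l c)^2 + 2 l (a c - b^2). Conversely, its minimum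
    is attained at l = b^2 / c^2, which is nonnegative, so testing only l >= 0 loses nothing. *)
Lemma sqr_le_mulP a b c : 0 <= a -> 0 <= c ->
  b ^+ 2 <= a * c <->
  forall l, 0 <= l -> 0 <= a ^+ 2 - 2 * l * b ^+ 2 + l ^+ 2 * c ^+ 2.
Proof.
move=> a0 c0; split=> [bac l l0|H].
  have -> : a ^+ 2 - 2 * l * b ^+ 2 + l ^+ 2 * c ^+ 2 =
    (a - l * c) ^+ 2 + 2 * l * (a * c - b ^+ 2) by ring.
  by rewrite addr_ge0 ?sqr_ge0// !mulr_ge0// subr_ge0.
(* From here on [b] denotes the former b^2; only its nonnegativity is used. *)
have b0 := sqr_ge0 b; move: {b} (b ^+ 2) b0 H => b b0 H.
have [c_eq0|cn0] := eqVneq c 0.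
  rewrite c_eq0 mulr0 leNgt; apply/negP => b_gt0.
  (* For c = 0 the polynomial is affine in l; if b > 0, this l gives it the value -1. *)
  have := H ((a ^+ 2 + 1) / (2 * b)) _; rewrite c_eq0 expr0n/= mulr0 addr0.
  have -> : 2 * ((a ^+ 2 + 1) / (2 * b)) * b = a ^+ 2 + 1.
    by field; rewrite gt_eqF.
  rewrite opprD addrA subrr add0r oppr_ge0 ler10.
  by rewrite divr_ge0 ?addr_ge0 ?sqr_ge0 ?mulr_ge0// => /(_ isT).
(* The minimiser of the quadratic. *)
have := H (b / c ^+ 2) (divr_ge0 b0 (sqr_ge0 c)).
have -> : a ^+ 2 - 2 * (b / c ^+ 2) * b + (b / c ^+ 2) ^+ 2 * c ^+ 2 =
  ((a * c) ^+ 2 - b ^+ 2) / c ^+ 2 by field.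
rewrite pmulr_lge0 ?invr_gt0 ?exprn_even_gt0// subr_ge0.
by rewrite ler_pXn2r// nnegrE// mulr_ge0.
Qed.

End discriminant.

(** * Real and imaginary parts, and a pointwise norm estimate *)

Section complex_parts.
Context (R : rcfType).
Implicit Types z w : R[i].

Lemma Re_addc z w : complex.Re (z + w) = complex.Re z + complex.Re w.
Proof. by case: z w => ? ? []. Qed.

Lemma Im_addc z w : complex.Im (z + w) = complex.Im z + complex.Im w.
Proof. by case: z w => ? ? []. Qed.

Lemma Re_mulc z w : complex.Re (z * w) =
  complex.Re z * complex.Re w - complex.Im z * complex.Im w.
Proof. by case: z w => ? ? []. Qed.

Lemma Im_mulc z w : complex.Im (z * w) =
  complex.Re z * complex.Im w + complex.Im z * complex.Re w.
Proof. by case: z w => ? ? []. Qed.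

Lemma Re_norm_sqr z :
  complex.Re `|z| ^+ 2 = complex.Re z ^+ 2 + complex.Im z ^+ 2.
Proof. by rewrite normc_def/= sqr_sqrtr// addr_ge0// sqr_ge0. Qed.

(** Parallelogram identity: the right side minus the left side is |a z - b w|^2, whose real and
    imaginary parts are [p] and [q] below. *)
Lemma Re_norm_sqr_lincomb (a b z w : R[i]) :
  complex.Re `|a * z + b * w| ^+ 2 <=
  2 * (complex.Re `|a| ^+ 2 * complex.Re `|z| ^+ 2 +
       complex.Re `|b| ^+ 2 * complex.Re `|w| ^+ 2).
Proof.
rewrite !Re_norm_sqr; move: a b z w => [a1 a2] [b1 b2] [f1 f2] [g1 g2] /=.
rewrite -subr_ge0.
pose p := a1 * f1 - a2 * f2 - (b1 * g1 - b2 * g2).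
pose q := a1 * f2 + a2 * f1 - (b1 * g2 + b2 * g1).
rewrite [leRHS](_ : _ = p ^+ 2 + q ^+ 2) ?addr_ge0 ?sqr_ge0//.
by rewrite /p /q; ring.
Qed.

End complex_parts.

(** * Complex integrals, the L2 norm and the inner product *)

Section L2_space.
Context (d : measure_display) (T : measurableType d) (R : realType).
Variable mu : {measure set T -> \bar R}.
Implicit Types (D : set T) (f g h : T -> R[i]) (A B : (T -> R[i]) -> T -> R[i]).

Definition Cintegrable D f :=
  mu.-integrable D (EFin \o (fun x => complex.Re (f x))) /\
  mu.-integrable D (EFin \o (fun x => complex.Im (f x))).

Lemma CintegralD D f g : measurable D ->
  Cintegrable D f -> Cintegrable D g ->
  Cintegral mu D (fun x => f x + g x) = Cintegral mu D f + Cintegral mu D g.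
Proof.
move=> mD [fr fi] [gr gi]; rewrite /Cintegral.
under eq_Rintegral do rewrite raddfD.
rewrite RintegralD//.
under [X in _ +i* X]eq_Rintegral do rewrite raddfD.
by rewrite RintegralD.
Qed.

Lemma CintegralZl D (a : R[i]) f : measurable D ->
  Cintegrable D f ->
  Cintegral mu D (fun x => a * f x) = a * Cintegral mu D f.
Proof.
move=> mD [fr fi]; rewrite /Cintegral.
under eq_Rintegral do rewrite Re_mulc.
under [X in _ +i* X]eq_Rintegral do rewrite Im_mulc.
have Z (c : R) (k : T -> R) : mu.-integrable D (EFin \o k) ->
    mu.-integrable D (EFin \o (fun x => c * k x)).
  by move=> ik; apply: eq_integrable (integrableZl mD c ik).
by rewrite RintegralB ?RintegralD ?RintegralZl//; try exact: Z; case: a => ? ?.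
Qed.

Lemma Cintegral_conj D f : measurable D -> Cintegrable D f ->
  Cintegral mu D (fun x => (f x)^*) = (Cintegral mu D f)^*.
Proof.
move=> mD [fr fi]; rewrite /Cintegral.
congr (_ +i* _).
  by apply: eq_Rintegral => x _; case: (f x).
have ImE x : complex.Im (f x)^* = -1 * complex.Im (f x).
  by rewrite mulN1r; case: (f x).
under eq_Rintegral do rewrite ImE.
by rewrite RintegralZl// mulN1r.
Qed.

Lemma poweR_eL2norm f :
  (eL2norm mu f `^ 2 = \int[mu]_x (complex.Re `|f x| ^+ 2)%:E)%E.
Proof.
rewrite /eL2norm poweR_Lnorm ?pnatr_eq0//; apply: eq_integral => x _ /=.
by rewrite powR_mulrn// real_normK// num_real.
Qed.

Lemma L2P f : L2 mu f <->
  [/\ measurable_fun setT (fun x => complex.Re (f x)),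
      measurable_fun setT (fun x => complex.Im (f x)) &
      (\int[mu]_x (complex.Re `|f x| ^+ 2)%:E < +oo)%E].
Proof.
rewrite -poweR_eL2norm; split=> -[mr mi fi]; split=> //; first exact: poweR_lty.
by apply: lty_poweRy fi; rewrite pnatr_eq0.
Qed.

Lemma L2norm_ge0 f : 0 <= L2norm mu f.
Proof. by rewrite fine_ge0// Lnorm_ge0. Qed.

Lemma L2norm_sqr f :
  L2norm mu f ^+ 2 = fine (\int[mu]_x (complex.Re `|f x| ^+ 2)%:E).
Proof.
by rewrite -poweR_eL2norm fine_poweR powR_mulrn// L2norm_ge0.
Qed.

Lemma L2_integrable f : L2 mu f ->
  mu.-integrable setT (EFin \o (fun x => complex.Re `|f x| ^+ 2)).
Proof.
move=> /L2P[mr mi fi]; apply/integrableP; split.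
  apply/measurable_EFinP; under eq_fun do rewrite Re_norm_sqr.
  by apply: measurable_funD; apply: measurable_funX.
by under eq_integral do rewrite gee0_abs ?lee_fin ?sqr_ge0//.
Qed.

Lemma L2_mulC f g : L2 mu f -> L2 mu g ->
  Cintegrable setT (fun x => f x * (g x)^*).
Proof.
move=> Lf Lg; have := integrableD measurableT (L2_integrable Lf) (L2_integrable Lg).
have [fr fi _] := Lf; have [gr gi _] := Lg => ifg.
have ReE x : complex.Re (f x * (g x)^*) =
    complex.Re (f x) * complex.Re (g x) + complex.Im (f x) * complex.Im (g x).
  by case: (f x) (g x) => a b [a' b'] /=; rewrite mulrN opprK.
have ImE x : complex.Im (f x * (g x)^*) =
    complex.Im (f x) * complex.Re (g x) - complex.Re (f x) * complex.Im (g x).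
  by case: (f x) (g x) => a b [a' b'] /=; ring.
(* Serves both parts of f conj(g): directly for the real part, and with (Im f, Re f) and (Re g, - Im
   g) for the imaginary part. *)
have bound (a b a' b' : R) : `|a * a' + b * b'| <=
    a ^+ 2 + b ^+ 2 + (a' ^+ 2 + b' ^+ 2).
  have [H1 H2] : 0 <= (a + a') ^+ 2 + (b + b') ^+ 2 /\
                 0 <= (a - a') ^+ 2 + (b - b') ^+ 2.
    by rewrite !addr_ge0 ?sqr_ge0.
  have := sqr_ge0 a; have := sqr_ge0 b; have := sqr_ge0 a'; have := sqr_ge0 b'.
  by rewrite ler_norml => ? ? ? ?; apply/andP; split; lra.
split; apply: le_integrable ifg => //.
- apply/measurable_EFinP; under eq_fun do rewrite ReE.
  by apply: measurable_funD; apply: measurable_funM.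
- move=> x _ /=; rewrite ReE !Re_norm_sqr !lee_fin [leRHS]ger0_norm ?addr_ge0 ?sqr_ge0//.
- apply/measurable_EFinP; under eq_fun do rewrite ImE.
  by apply: measurable_funB; apply: measurable_funM.
- move=> x _ /=; rewrite ImE !Re_norm_sqr !lee_fin [leRHS]ger0_norm ?addr_ge0 ?sqr_ge0//.
  have := bound (complex.Im (f x)) (complex.Re (f x)) (complex.Re (g x))
    (- complex.Im (g x)).
  by rewrite sqrrN mulrN (addrC (_ (f x) ^+ 2)).
Qed.

Lemma L2inner_norm f : L2 mu f -> L2inner mu f f = (L2norm mu f ^+ 2)%:C.
Proof.
move=> Lf; rewrite L2norm_sqr /L2inner /Cintegral.
have E x : f x * (f x)^* = (complex.Re `|f x| ^+ 2)%:C.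
  by rewrite Re_norm_sqr add_Re2_Im2 normCK.
congr (_ +i* _).
  by rewrite /Rintegral; congr fine; apply: eq_integral => x _; rewrite E.
under eq_Rintegral do rewrite E/=.
by rewrite Rintegral_cst ?mul0r.
Qed.

Lemma L2innerDl f g h : L2 mu f -> L2 mu g -> L2 mu h ->
  L2inner mu (fun x => f x + g x) h = L2inner mu f h + L2inner mu g h.
Proof.
move=> Lf Lg Lh; rewrite -CintegralD//; try exact: L2_mulC.
by congr Cintegral; apply/funext => x; rewrite mulrDl.
Qed.

Lemma L2innerZl (a : R[i]) f h : L2 mu f -> L2 mu h ->
  L2inner mu (fun x => a * f x) h = a * L2inner mu f h.
Proof.
move=> Lf Lh; rewrite -CintegralZl//; try exact: L2_mulC.
by congr Cintegral; apply/funext => x; rewrite mulrA.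
Qed.

Lemma L2inner_conj f g : L2 mu f -> L2 mu g ->
  (L2inner mu f g)^* = L2inner mu g f.
Proof.
move=> Lf Lg; rewrite -Cintegral_conj//; last exact: L2_mulC.
by congr Cintegral; apply/funext => x; rewrite rmorphM/= conjCK mulrC.
Qed.

(** Membership and norm bound both come from integrating the same pointwise bound [k]. The squared
    form with factor 2 is cruder than the triangle inequality but suffices for boundedness of
    operators. *)
Lemma L2_lincomb (a b : R[i]) f g : L2 mu f -> L2 mu g ->
  L2 mu (fun x => a * f x + b * g x) /\
  L2norm mu (fun x => a * f x + b * g x) ^+ 2 <=
    2 * (complex.Re `|a| ^+ 2 * L2norm mu f ^+ 2 +
         complex.Re `|b| ^+ 2 * L2norm mu g ^+ 2).
Proof.
move=> Lf Lg; set h := fun x => _.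
have [fr fi _] := Lf; have [gr gi _] := Lg.
have If := L2_integrable Lf; have Ig := L2_integrable Lg.
pose k x := 2 * (complex.Re `|a| ^+ 2 * complex.Re `|f x| ^+ 2 +
                 complex.Re `|b| ^+ 2 * complex.Re `|g x| ^+ 2).
have If' := integrableZl measurableT (complex.Re `|a| ^+ 2) If.
have Ig' := integrableZl measurableT (complex.Re `|b| ^+ 2) Ig.
have Ik : mu.-integrable setT (EFin \o k).
  by apply: eq_integrable (integrableZl measurableT 2 (integrableD measurableT If' Ig')).
have hk x : complex.Re `|h x| ^+ 2 <= k x.
  exact: Re_norm_sqr_lincomb.
have mh1 : measurable_fun setT (fun x => complex.Re (h x)).
  under eq_fun do rewrite /h Re_addc !Re_mulc.
  by apply: measurable_funD; apply: measurable_funB; apply: measurable_funM.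
have mh2 : measurable_fun setT (fun x => complex.Im (h x)).
  under eq_fun do rewrite /h Im_addc !Im_mulc.
  by apply: measurable_funD; apply: measurable_funD; apply: measurable_funM.
have hle : (\int[mu]_x (complex.Re `|h x| ^+ 2)%:E <= \int[mu]_x (k x)%:E)%E.
  apply: ge0_le_integral => //.
  - by move=> x _; rewrite lee_fin sqr_ge0.
  - apply/measurable_EFinP; under eq_fun do rewrite Re_norm_sqr.
    by apply: measurable_funD; apply: measurable_funX.
  - exact: measurable_int Ik.
  - by move=> x _; rewrite lee_fin.
have kfin := integrable_fin_num measurableT Ik.
split.
  by apply/L2P; split; [by []|by []|]; apply: le_lt_trans hle _; rewrite ltey_eq kfin.
rewrite !L2norm_sqr; apply: le_trans (fine_le _ kfin hle) _.
  rewrite ge0_fin_numE; last by apply: integral_ge0 => x _; rewrite lee_fin sqr_ge0.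
  by apply: le_lt_trans hle _; rewrite ltey_eq kfin.
rewrite -/(Rintegral mu setT k) RintegralZl//; last exact: integrableD If' Ig'.
rewrite RintegralD// ?RintegralZl//.
Qed.

End L2_space.

(** * Bounded operators, adjoints and positivity of pencils *)

Section bounded_operators.
Context (d : measure_display) (T : measurableType d) (R : realType).
Variable mu : {measure set T -> \bar R}.
Implicit Types (f g h : T -> R[i]) (A B X Y Z : (T -> R[i]) -> T -> R[i]).

(** Squared norms are plain integrals, so boundedness is easier to check and combine in this
    form. *)
Lemma bounded_operator_sqr A :
  bounded_operator mu A <->
  [/\ forall f, L2 mu f -> L2 mu (A f),
      forall (a : R[i]) f g, L2 mu f -> L2 mu g ->
        A (fun x => a * f x + g x) = (fun x => a * A f x + A g x)
    & exists2 K : R, 0 <= K &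
      forall f, L2 mu f -> L2norm mu (A f) ^+ 2 <= K * L2norm mu f ^+ 2].
Proof.
split=> -[AL2 Alin [K]].
  move=> AK; split => //; exists (K ^+ 2); first exact: sqr_ge0.
  move=> f Lf; rewrite -exprMn ler_pXn2r// ?nnegrE ?L2norm_ge0 ?AK//.
  (* [K] may be negative here; its product with the norm of f is nonnegative because it dominates a
     norm. *)
  exact: le_trans (L2norm_ge0 _ _) (AK f Lf).
move=> K0 AK; split => //; exists (Num.sqrt K) => f Lf.
rewrite -(@ler_pXn2r _ 2)// ?nnegrE ?mulr_ge0 ?sqrtr_ge0 ?L2norm_ge0//.
by rewrite exprMn sqr_sqrtr// AK.
Qed.

Lemma bounded_operator_id : bounded_operator mu id.
Proof. by split=> //; exists 1 => f _; rewrite mul1r. Qed.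

Lemma bounded_operator_comp A B :
  bounded_operator mu A -> bounded_operator mu B ->
  bounded_operator mu (A \o B).
Proof.
move=> /bounded_operator_sqr[AL2 Alin [K K0 AK]].
move=> /bounded_operator_sqr[BL2 Blin [M M0 BM]].
apply/bounded_operator_sqr; split=> /=.
- by move=> f Lf; apply/AL2/BL2.
- by move=> a f g Lf Lg; rewrite Blin// Alin//; exact: BL2.
- exists (K * M) => [|f Lf]; first exact: mulr_ge0.
  apply: le_trans (AK _ (BL2 _ Lf)) _; rewrite -mulrA ler_wpM2l//.
  exact: BM.
Qed.

Lemma bounded_operator_lincomb (a b : R[i]) A B :
  bounded_operator mu A -> bounded_operator mu B ->
  bounded_operator mu (fun f x => a * A f x + b * B f x).
Proof.
move=> /bounded_operator_sqr[AL2 Alin [K K0 AK]].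
move=> /bounded_operator_sqr[BL2 Blin [M M0 BM]].
apply/bounded_operator_sqr; split=> /=.
- by move=> f Lf; have [] := L2_lincomb a b (AL2 _ Lf) (BL2 _ Lf).
- move=> c f g Lf Lg; rewrite Alin// Blin//; apply/funext => x; ring.
- exists (2 * (complex.Re `|a| ^+ 2 * K + complex.Re `|b| ^+ 2 * M)).
    by rewrite mulr_ge0// addr_ge0// mulr_ge0// sqr_ge0.
  move=> f Lf; have [_] := L2_lincomb a b (AL2 _ Lf) (BL2 _ Lf).
  move=> /le_trans; apply; rewrite -(mulrA 2) ler_wpM2l// mulrDl.
  by rewrite lerD// -[leRHS]mulrA ler_wpM2l ?sqr_ge0// ?AK ?BM.
Qed.

Lemma is_adjoint_id : is_adjoint mu id id.
Proof. by split => //; exact: bounded_operator_id. Qed.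

Lemma is_adjoint_sym A B :
  bounded_operator mu A -> is_adjoint mu A B -> is_adjoint mu B A.
Proof.
move=> bA [[BL2 _ _] AB]; have [AL2 _ _] := bA; split => // f g Lf Lg.
by rewrite -L2inner_conj -?AB ?L2inner_conj//; [exact: AL2|exact: BL2].
Qed.

Lemma is_adjoint_comp A A' B B' :
  bounded_operator mu B -> is_adjoint mu A A' -> is_adjoint mu B B' ->
  is_adjoint mu (A \o B) (B' \o A').
Proof.
move=> [BL2 _ _] [bA' AA'] [bB' BB']; split.
  exact: bounded_operator_comp.
move=> f g Lf Lg /=; have [A'L2 _ _] := bA'.
by rewrite AA' ?BB'//; [exact: A'L2|exact: BL2].
Qed.

(** Uniqueness of the adjoint, in the form needed to replace the existentially quantified adjoint by
    a concrete one: |Bf|^2 = <ABf, f> = <Bf, B'f>, and symmetrically |B'f|^2 = <B'f, Bf>. These are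
    conjugate and real, hence equal. *)
Lemma is_adjoint_L2norm A B B' f : is_adjoint mu A B -> is_adjoint mu A B' ->
  L2 mu f -> L2norm mu (B f) = L2norm mu (B' f).
Proof.
move=> [[BL2 _ _] AB] [[B'L2 _ _] AB'] Lf.
have E : (L2norm mu (B f) ^+ 2)%:C = (L2norm mu (B' f) ^+ 2)%:C.
  rewrite -!L2inner_norm//; [|exact: B'L2|exact: BL2].
  rewrite -[in RHS]AB'//; last exact: B'L2.
  rewrite AB//; last exact: B'L2.
  rewrite -[in LHS]AB//; last exact: BL2.
  rewrite AB'//; last exact: BL2.
  rewrite -[RHS]L2inner_conj; [|exact: BL2|exact: B'L2].
  suff -> : L2inner mu (B f) (B' f) = (L2norm mu (B f) ^+ 2)%:C.
    by rewrite conj_Creal// complex_real.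
  rewrite -AB'//; last exact: BL2.
  by rewrite AB ?L2inner_norm//; exact: BL2.
apply/eqP; rewrite -(@eqrXn2 _ 2)// ?L2norm_ge0//; apply/eqP.
by case: E.
Qed.

Lemma eq_positive_operator A B : (forall f x, A f x = B f x) ->
  positive_operator mu A -> positive_operator mu B.
Proof.
by move=> AB; suff -> : A = B by []; apply/funext => f; apply/funext => x.
Qed.

(** The quadratic form of the pencil at f is |Xf|^2 - 2 l |Yf|^2 + l^2 |Zf|^2, so [sqr_le_mulP]
    applies for each fixed f. Boundedness of the pencil is part of positivity and is proved along
    the way. *)
Lemma positive_operator_pencilP X X' Y Y' Z Z' :
  bounded_operator mu X -> bounded_operator mu Y -> bounded_operator mu Z ->
  is_adjoint mu X X' -> is_adjoint mu Y Y' -> is_adjoint mu Z Z' ->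
  (forall f, L2 mu f ->
    L2norm mu (Y f) ^+ 2 <= L2norm mu (X f) * L2norm mu (Z f)) <->
  (forall l : R, 0 <= l -> positive_operator mu (fun f v =>
    X' (X f) v - 2 * l%:C * Y' (Y f) v + l%:C ^+ 2 * Z' (Z f) v)).
Proof.
move=> bX bY bZ aX aY aZ.
have bounded_square A A' : bounded_operator mu A -> is_adjoint mu A A' ->
    bounded_operator mu (A' \o A).
  by move=> bA [bA' _]; exact: bounded_operator_comp.
have inner_square A A' f : bounded_operator mu A -> is_adjoint mu A A' ->
    L2 mu f -> L2inner mu (A' (A f)) f = (L2norm mu (A f) ^+ 2)%:C.
  move=> bA aA Lf; have [_ ->//] := is_adjoint_sym bA aA.
    by rewrite L2inner_norm//; have [+ _ _] := bA; exact.
  by have [+ _ _] := bA; exact.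
(* Nested two-term combinations, the shape accepted by [bounded_operator_lincomb]. *)
have pencilE l f v : X' (X f) v - 2 * l%:C * Y' (Y f) v +
      l%:C ^+ 2 * Z' (Z f) v =
    1 * (1 * (X' \o X) f v + (- (2 * l%:C)) * (Y' \o Y) f v) +
      l%:C ^+ 2 * (Z' \o Z) f v.
  by rewrite /=; ring.
have bXX := bounded_square _ _ bX aX; have bYY := bounded_square _ _ bY aY.
have bZZ := bounded_square _ _ bZ aZ.
have bXY l := bounded_operator_lincomb 1 (- (2 * l%:C)) bXX bYY.
have bP l := bounded_operator_lincomb 1 (l%:C ^+ 2) (bXY l) bZZ.
have innerE l f : L2 mu f -> L2inner mu (fun v =>
      X' (X f) v - 2 * l%:C * Y' (Y f) v + l%:C ^+ 2 * Z' (Z f) v) f =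
    (L2norm mu (X f) ^+ 2 - 2 * l * L2norm mu (Y f) ^+ 2 +
     l ^+ 2 * L2norm mu (Z f) ^+ 2)%:C.
  move=> Lf; under eq_fun do rewrite pencilE.
  have [XXL _ _] := bXX; have [YYL _ _] := bYY; have [ZZL _ _] := bZZ.
  have LZ (a : R[i]) h : L2 mu h -> L2 mu (fun x => a * h x).
    move=> Lh; have [+ _] := L2_lincomb a 0 Lh Lh.
    by under eq_fun do rewrite mul0r addr0.
  have LD h k : L2 mu h -> L2 mu k -> L2 mu (fun x => h x + k x).
    move=> Lh Lk; have [+ _] := L2_lincomb 1 1 Lh Lk.
    by under eq_fun do rewrite !mul1r.
  have LX := XXL _ Lf; have LY := YYL _ Lf; have LZf := ZZL _ Lf.
  have LX1 := LZ 1 _ LX; have LY1 := LZ (- (2 * l%:C)) _ LY.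
  rewrite (L2innerDl (LZ 1 _ (LD _ _ LX1 LY1)) (LZ (l%:C ^+ 2) _ LZf) Lf).
  rewrite (L2innerZl _ (LD _ _ LX1 LY1) Lf) (L2innerDl LX1 LY1 Lf).
  rewrite (L2innerZl _ LX Lf) (L2innerZl _ LY Lf) (L2innerZl _ LZf Lf).
  rewrite (inner_square _ _ _ bX aX Lf) (inner_square _ _ _ bY aY Lf).
  by rewrite (inner_square _ _ _ bZ aZ Lf); ring.
split=> [H l l0|H f Lf].
  split; first by under eq_fun do under eq_fun do rewrite pencilE; exact: bP.
  move=> f Lf; rewrite innerE// ler0c.
  by move: l l0; apply/sqr_le_mulP; rewrite ?L2norm_ge0 ?H.
apply/sqr_le_mulP; rewrite ?L2norm_ge0// => l l0.
by have [_ /(_ _ Lf)] := H _ l0; rewrite innerE// ler0c.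
Qed.

End bounded_operators.

(** With z the sum on the left, expand 0 <= sum |K g - z u|^2 p and use that the weight of u is at
    most K. A positive upper bound K instead of that weight itself spares the degenerate case u =
    0. *)
Lemma weighted_Cauchy_Schwarz (C : numClosedFieldType) (I : Type) (s : seq I)
    (u g p : I -> C) (K : C) : (forall i, 0 <= p i) -> 0 < K ->
  \sum_(i <- s) `|u i| ^+ 2 * p i <= K ->
  `|\sum_(i <- s) (u i)^* * g i * p i| ^+ 2 <=
    K * \sum_(i <- s) `|g i| ^+ 2 * p i.
Proof.
move=> p0 K0; set U := \sum_(i <- s) _; set z := \sum_(i <- s) _.
set G := \sum_(i <- s) _ => UK.
have pJ i : (p i)^* = p i by rewrite conj_Creal// ger0_real.
have KJ : K^* = K by rewrite conj_Creal// gtr0_real.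
have zJ : z^* = \sum_(i <- s) u i * (g i)^* * p i.
  by rewrite rmorph_sum; apply: eq_bigr => i _; rewrite !rmorphM/= conjCK pJ.
have zE : \sum_(i <- s) (u i)^* * g i * p i = z by [].
clearbody z; have : 0 <= \sum_(i <- s) `|K * g i - z * u i| ^+ 2 * p i.
  by apply: sumr_ge0 => i _; rewrite mulr_ge0// exprn_ge0.
have -> : \sum_(i <- s) `|K * g i - z * u i| ^+ 2 * p i =
    K ^+ 2 * G - 2 * K * `|z| ^+ 2 + `|z| ^+ 2 * U.
  transitivity (K ^+ 2 * G - K * z^* * (\sum_(i <- s) (u i)^* * g i * p i)
      - K * z * (\sum_(i <- s) u i * (g i)^* * p i) + `|z| ^+ 2 * U).
    rewrite /G /U !mulr_sumr -!sumrB -big_split/=.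
    by apply: eq_bigr => i _; rewrite !normCK rmorphB !rmorphM/= KJ; ring.
  by rewrite -zJ zE normCK; ring.
move=> H; rewrite -(ler_pM2l K0) -subr_ge0; apply: le_trans H _.
rewrite -subr_ge0.
have -> : K * (K * G) - K * `|z| ^+ 2 -
    (K ^+ 2 * G - 2 * K * `|z| ^+ 2 + `|z| ^+ 2 * U) = `|z| ^+ 2 * (K - U).
  ring.
by rewrite mulr_ge0 ?exprn_ge0// subr_ge0.
Qed.

(** * Fibres of the iterated parent map as finite lists *)

Section descendants.
Context (m : nat) (eta : 'I_m.+1 -> nat).
Local Notation V := (vertex eta).
Implicit Types (v w : V) (n : nat).

(** A circuit vertex has the next circuit vertex and the first vertex of each of its branches as
    children; when the circuit has one vertex, it is its own child. *)
Definition children v : seq V :=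
  match v with
  | circuit r => circuit (ordS r) :: [seq branch r i 0 | i : 'I_(eta r)]
  | branch r i j => [:: branch r i j.+1]
  end.

Fixpoint descendants n v : seq V :=
  if n is n'.+1 then flatten [seq descendants n' w | w <- children v]
  else [:: v].

Lemma mem_children v w : (w \in children v) = (parent w == v).
Proof.
apply/idP/eqP => [|<-].
  case: v => [r|r i j] /=; last by rewrite inE => /eqP ->.
  by rewrite inE => /predU1P[->|/mapP[i _ ->//]] /=; rewrite ordSK.
case: w => [r|r i [|j]] /=; rewrite inE ?ord_predK ?eqxx//=.
by apply: map_f; rewrite mem_enum.
Qed.

Lemma children_uniq v : uniq (children v).
Proof.
case: v => [r|//] /=; rewrite map_inj_uniq ?enum_uniq ?andbT.
  by apply/mapP => -[].
move=> i j ij.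
(* The type of the branch index depends on r, so injectivity is read off from [vertex_code] as an
   equality of tagged pairs with the same tag. The [else] value below is never reached. *)
have E : Tagged (fun r => ('I_(eta r) * nat)%type) (i, 0) =
    Tagged (fun r => ('I_(eta r) * nat)%type) (j, 0).
  exact: (congr1 (fun w =>
    if vertex_code w is inr c then c else existT _ r (i, 0)) ij).
by have /(congr1 fst) := eq_from_Tagged E.
Qed.

Lemma mem_descendants n v w :
  (w \in descendants n v) = (iter n (@parent m eta) w == v).
Proof.
elim: n v => [|n IHn] v; first by rewrite inE.
apply/flatten_mapP/eqP => [[x] | <-].
  by rewrite mem_children IHn => /eqP <- /eqP <-.
by exists (iter n (@parent m eta) w); rewrite ?mem_children ?IHn//= eqxx.
Qed.

(** Descendant lists of distinct children are disjoint, because the n-th ancestor of a vertex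
    determines which child it comes from. *)
Lemma descendants_uniq n v : uniq (descendants n v).
Proof.
elim: n v => [|n IHn] v //=.
elim: (children v) (children_uniq v) => //= w s IHs /andP[ws us].
rewrite cat_uniq IHn IHs// andbT; apply/hasPn => x /flatten_mapP[y ys].
rewrite !mem_descendants => /eqP xy; apply: contra ws => /eqP <-.
by rewrite xy.
Qed.

Lemma descendants1 v : descendants 1 v = children v.
Proof. by rewrite /= flatten_map1 map_id. Qed.

Lemma atomE n v : atom n v = [set` descendants n v].
Proof.
by apply/seteqP; split=> w /=; rewrite mem_descendants => /eqP.
Qed.

End descendants.

(** * Integrals over fibres as finite sums, and integration fibre by fibre *)

Section integrals.
Context (R : realType) (m : nat) (eta : 'I_m.+1 -> nat).
Variable mu : {measure set (vertex eta) -> \bar R}.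
Hypothesis mu_fin : forall v : vertex eta, (0 < mu [set v] < +oo)%E.
Local Notation V := (vertex eta).
Implicit Types (f g : V -> R[i]) (v w : V) (n : nat) (s : seq V) (F G : V -> R).

Definition mass v : R := fine (mu [set v]).

Lemma mass_gt0 v : 0 < mass v.
Proof. exact: fine_gt0. Qed.

Lemma massE v : mu [set v] = (mass v)%:E.
Proof.
by have /andP[v0 voo] := mu_fin v; rewrite fineK// ge0_fin_numE// ltW.
Qed.

Lemma vertex_measurable (A : set V) : measurable A.
Proof. by []. Qed.
Hint Resolve vertex_measurable : core.

Lemma vertex_measurable_fun d (T : measurableType d) (A : set V) (F : V -> T) :
  measurable_fun A F.
Proof. by []. Qed.
Hint Resolve vertex_measurable_fun : core.

Lemma integral_vertex v F :
  (\int[mu]_(x in [set v]) (F x)%:E = (F v * mass v)%:E)%E.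
Proof.
rewrite (@eq_integral _ _ _ _ _ (cst (F v)%:E)); last first.
  by move=> x; rewrite inE => ->.
by rewrite integral_cst// massE.
Qed.

Lemma integral_seq s F : uniq s ->
  (\int[mu]_(x in [set` s]) (F x)%:E = (\sum_(x <- s) F x * mass x)%:E)%E.
Proof.
elim: s => [_|x s IHs /= /andP[xs us]].
  by rewrite set_nil integral_set0 big_nil.
have -> : [set` x :: s] = [set x] `|` [set` s].
  by apply/seteqP; split=> y /=; rewrite inE => /predU1P.
rewrite integral_setU//; last first.
  by apply/disj_setPS => y [/= ->]; rewrite (negbTE xs).
by rewrite IHs// integral_vertex big_cons EFinD.
Qed.

Lemma fine_mu_seq s : uniq s -> fine (mu [set` s]) = \sum_(x <- s) mass x.
Proof.
move=> us; have := integral_seq (fun=> 1) us.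
rewrite -/(cst 1%:E) integral_cst// mul1e => ->.
by apply: eq_bigr => x _; rewrite mul1r.
Qed.

Lemma Cintegral_seq s f : uniq s ->
  Cintegral mu [set` s] f = \sum_(x <- s) f x * (mass x)%:C.
Proof.
move=> us; rewrite /Cintegral /Rintegral !integral_seq//=.
apply/eqP; rewrite eq_complex/=; apply/andP; split; apply/eqP.
  rewrite (big_morph _ (@Re_addc R) (erefl _)); apply: eq_bigr => x _.
  by rewrite Re_mulc/= mulr0 subr0.
rewrite (big_morph _ (@Im_addc R) (erefl _)); apply: eq_bigr => x _.
by rewrite Im_mulc/= mulr0 add0r.
Qed.

(** The mass of the fibre is the numerator of h_n and the denominator of the conditional
    expectation, so it cancels. *)
Lemma RNderiv_condE_pull n g v :
  (RNderiv mu n v)%:C * condE_pull mu n g v =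
  (\sum_(x <- descendants n v) g x * (mass x)%:C) / (mass v)%:C.
Proof.
have us := descendants_uniq n v.
rewrite /RNderiv /condE_pull atomE Cintegral_seq// fine_mu_seq// -/(mass v).
set S := \sum_(x <- _) mass x.
have [S0|Sn0] := eqVneq S 0; last first.
  have SC : S%:C != 0 by rewrite (fmorph_eq0 (real_complex R)).
  by rewrite rmorphM fmorphV/=; field; rewrite SC fmorph_eq0 gt_eqF ?mass_gt0.
(* If the fibre had mass 0, positivity of point masses would leave no term in the sum, and both
   sides would be 0. *)
rewrite S0 mul0r rmorph0 mul0r big_seq big1 ?mul0r// => x xs.
move/eqP: S0; rewrite psumr_eq0; last by move=> y _; exact/ltW/mass_gt0.
by move=> /allP/(_ _ xs) /=; rewrite gt_eqF// mass_gt0.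
Qed.

Lemma integral_support s F : uniq s -> (forall x, x \notin s -> F x = 0) ->
  (\int[mu]_x (F x)%:E = (\sum_(x <- s) F x * mass x)%:E)%E.
Proof.
move=> us F0; rewrite -integral_seq// [RHS]integral_mkcond.
apply: eq_integral => x _; rewrite patchE.
by case: ifPn => //; rewrite notin_setE/= => /negP /F0 ->.
Qed.

(* The fibres of [phi] are indexed by the codes of their base points, since the
   countable additivity of integrals is stated for sequences of sets. *)
Let fibre (phi : V -> V) (k : nat) : set V := [set w | pickle (phi w) = k].

Let bigcup_fibre phi : \bigcup_k fibre phi k = setT.
Proof. by apply/seteqP; split=> // w _; exists (pickle (phi w)). Qed.

Let trivIset_fibre phi : trivIset setT (fibre phi).
Proof. by move=> i j _ _ [w [/= <- <-]]. Qed.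

(** A code k is either that of one vertex v, and the two fibres are {v} and the children of v, or of
    none, and both are empty. *)
Let fibreP (P : set V -> set V -> Prop) : P set0 set0 ->
  (forall v, P [set v] [set` children v]) ->
  forall k, P (fibre id k) (fibre (@parent m eta) k).
Proof.
move=> P0 P1 k.
have [[v vk]|nk] := pselect (exists v : V, pickle v = k).
  have -> : fibre id k = [set v].
    apply/seteqP; split=> w /=; last by move->.
    by rewrite /fibre/= -vk => /(pcan_inj (@pickleK _)).
  suff -> : fibre (@parent m eta) k = [set` children v] by [].
  apply/seteqP; split=> w /=; rewrite mem_children /fibre/= -vk.
    by move=> /(pcan_inj (@pickleK _)) ->.
  by move=> /eqP ->.
suff [-> ->] : fibre id k = set0 /\ fibre (@parent m eta) k = set0 by [].
by split; apply/seteqP; split=> // w wk; apply: nk; eexists; exact: wk.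
Qed.

(** Singletons and fibres of the parent map both partition the space; the integral of G is split
    along the first partition, that of F along the second, and they are compared piece by piece. *)
Lemma ge0_le_integral_fibres F G :
  (forall v, 0 <= F v) -> (forall v, 0 <= G v) ->
  (forall v, G v * mass v <= \sum_(x <- children v) F x * mass x) ->
  (\int[mu]_x (G x)%:E <= \int[mu]_x (F x)%:E)%E.
Proof.
move=> F0 G0 GF; rewrite -(bigcup_fibre id) ge0_integral_bigcup//; first last.
- by move=> x _; rewrite lee_fin.
rewrite (bigcup_fibre id) -(bigcup_fibre (@parent m eta)).
rewrite ge0_integral_bigcup//; last by move=> x _; rewrite lee_fin.
apply: lee_nneseries => [k _ _|k _].
  by apply: integral_ge0 => x _; rewrite lee_fin.
apply: (@fibreP (fun A B => (\int[mu]_(x in A) (G x)%:E <=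
  \int[mu]_(x in B) (F x)%:E)%E)) => [|v]; first by rewrite !integral_set0.
rewrite integral_seq ?children_uniq//.
by rewrite integral_vertex lee_fin.
Qed.

(** The same comparison with equality, where integrability replaces the sign condition in justifying
    countable additivity. *)
Lemma eq_Rintegral_fibres F G :
  mu.-integrable setT (EFin \o F) -> mu.-integrable setT (EFin \o G) ->
  (forall v, G v * mass v = \sum_(x <- children v) F x * mass x) ->
  \int[mu]_x G x = \int[mu]_x F x.
Proof.
move=> iF iG GF; congr fine.
rewrite -[in LHS](bigcup_fibre id) integral_bigcup ?bigcup_fibre//.
rewrite -(bigcup_fibre (@parent m eta)) integral_bigcup ?bigcup_fibre//.
apply: eq_eseriesr => k _.
apply: (@fibreP (fun A B => (\int[mu]_(x in A) (G x)%:E =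
  \int[mu]_(x in B) (F x)%:E)%E)) => [|v]; first by rewrite !integral_set0.
rewrite integral_seq ?children_uniq//.
by rewrite integral_vertex GF.
Qed.

Lemma eq_Cintegral_fibres f g :
  Cintegrable mu setT f -> Cintegrable mu setT g ->
  (forall v, g v * (mass v)%:C = \sum_(x <- children v) f x * (mass x)%:C) ->
  Cintegral mu setT g = Cintegral mu setT f.
Proof.
move=> [fr fi] [gr gi] gf; congr (_ +i* _); apply: eq_Rintegral_fibres => // v.
  have := congr1 (@complex.Re R) (gf v).
  rewrite (big_morph _ (@Re_addc R) (erefl _)) Re_mulc/= mulr0 subr0 => ->.
  by apply: eq_bigr => x _; rewrite Re_mulc/= mulr0 subr0.
have := congr1 (@complex.Im R) (gf v).
rewrite (big_morph _ (@Im_addc R) (erefl _)) Im_mulc/= mulr0 add0r => ->.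
by apply: eq_bigr => x _; rewrite Im_mulc/= mulr0 add0r.
Qed.

Lemma vertex_L2P f :
  L2 mu f <-> (\int[mu]_x (complex.Re `|f x| ^+ 2)%:E < +oo)%E.
Proof. by split=> [/L2P[]|fi] //; apply/L2P. Qed.

End integrals.

(** * The adjoint of the weighted composition operator *)

Section weighted_composition_adjoint.
Context (R : realType) (m : nat) (eta : 'I_m.+1 -> nat).
Variable mu : {measure set (vertex eta) -> \bar R}.
Hypothesis mu_fin : forall v : vertex eta, (0 < mu [set v] < +oo)%E.
Local Notation V := (vertex eta).
Variable u : V -> R[i].
Implicit Types (f g : V -> R[i]) (v w : V) (n : nat).
Local Notation p v := (mass mu v)%:C.

Definition wcomp_adj g : V -> R[i] := fun v =>
  (RNderiv mu 1 v)%:C * condE_pull mu 1 (fun w => (u w)^* * g w) v.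

Let mass_neq0 v : p v != 0.
Proof. by rewrite (fmorph_eq0 (real_complex R)) gt_eqF ?mass_gt0. Qed.

Lemma wcomp_adjE g v :
  wcomp_adj g v = (\sum_(x <- children v) (u x)^* * g x * p x) / p v.
Proof. by rewrite /wcomp_adj RNderiv_condE_pull// descendants1. Qed.

Lemma iter_wcomp n f v : iter n (wcomp u) f v =
  (\prod_(k < n) u (iter k (@parent m eta) v)) * f (iter n (@parent m eta) v).
Proof.
elim: n v => [|n IHn] v; first by rewrite big_ord0 mul1r.
rewrite iterS {1}/wcomp IHn -iterSr big_ord_recl/= -mulrA; congr (_ * (_ * _)).
by apply: eq_bigr => k _; rewrite -iterSr.
Qed.

Lemma iter_wcomp_adj n g v : iter n wcomp_adj g v =
  (\sum_(x <- descendants n v)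
     (\prod_(k < n) u (iter k (@parent m eta) x))^* * g x * p x) / p v.
Proof.
elim: n v => [|n IHn] v.
  by rewrite big_seq1 big_ord0 rmorph1 mul1r mulfK.
rewrite iterS wcomp_adjE [descendants _ _]/= big_flatten big_map; congr (_ / _).
(* The division by the mass of the child w, coming from the induction hypothesis, cancels against
   the weight of w in the outer sum. *)
apply: eq_bigr => w _; rewrite IHn mulrA mulfVK// mulr_sumr big_seq [RHS]big_seq.
apply: eq_bigr => x; rewrite mem_descendants => /eqP xw.
(* The n-th ancestor of x is w, so the last factor of the product for n + 1 is u(w). *)
by rewrite big_ord_recr/= xw [in RHS]rmorphM/= mulrC -!mulrA; congr (_ * _); ring.
Qed.

(** On the fibre over v the factor f o psi^n is the constant f(v) and leaves the sum; the products
    of u meet their conjugates and give |u|_n^2. *)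
Lemma iter_wcomp_adj_wcomp n f v :
  iter n wcomp_adj (iter n (wcomp u) f) v =
  (RNderiv mu n v)%:C * condE_pull mu n (sqnormn u n) v * f v.
Proof.
rewrite iter_wcomp_adj RNderiv_condE_pull// [RHS]mulrAC [in RHS]mulr_suml; congr (_ / _).
rewrite big_seq [RHS]big_seq; apply: eq_bigr => x.
rewrite mem_descendants => /eqP xv; rewrite iter_wcomp xv mulrA -normCKC.
rewrite normr_prod -prodrXl /sqnormn; ring.
Qed.

Lemma wcomp_adj_wcomp f v : wcomp_adj (wcomp u f) v =
  (RNderiv mu 1 v)%:C * condE_pull mu 1 (fun w => `|u w| ^+ 2) v * f v.
Proof.
have -> : (fun w => `|u w| ^+ 2) = sqnormn u 1.
  by apply/funext => w; rewrite /sqnormn big_ord1.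
exact: (iter_wcomp_adj_wcomp 1 f v).
Qed.

Lemma wcomp_wcomp_adj f v : wcomp u (wcomp_adj f) v =
  u v * (RNderiv mu 1 (parent v))%:C * condE mu 1 (fun w => (u w)^* * f w) v.
Proof. by rewrite -mulrA. Qed.

Hypothesis W_bounded : bounded_operator mu (wcomp u).

(* Boundedness of W is tested on the indicator functions of single vertices. *)
Lemma sum_children_weight_le : exists2 K : R, 0 < K & forall v,
  \sum_(x <- children v) complex.Re `|u x| ^+ 2 * mass mu x <= K * mass mu v.
Proof.
move/bounded_operator_sqr: W_bounded => [WL2 _ [K K0 WK]].
(* Adding 1 makes the constant strictly positive, as [weighted_Cauchy_Schwarz] requires. *)
exists (K + 1) => [|v]; first by rewrite ltr_pwDr.
pose e : V -> R[i] := fun w => (w == v)%:R.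
have eE : (\int[mu]_x (complex.Re `|e x| ^+ 2)%:E = (mass mu v)%:E)%E.
  rewrite (@integral_support _ _ _ _ mu_fin [:: v])//.
    by rewrite big_seq1 /e eqxx normr1 expr1n mul1r.
  by move=> x; rewrite inE /e => /negbTE ->; rewrite normr0 expr0n.
have WeE : (\int[mu]_x (complex.Re `|wcomp u e x| ^+ 2)%:E =
    (\sum_(x <- children v) complex.Re `|u x| ^+ 2 * mass mu x)%:E)%E.
  rewrite (@integral_support _ _ _ _ mu_fin (children v)) ?children_uniq//.
    congr EFin; rewrite big_seq [RHS]big_seq; apply: eq_bigr => x.
    by rewrite mem_children /wcomp /e => ->; rewrite mulr1.
  move=> x; rewrite mem_children /wcomp /e => /negbTE ->.
  by rewrite mulr0 normr0 expr0n.
have Le : L2 mu e by apply/vertex_L2P; rewrite eE ltry.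
have := WK _ Le; rewrite !L2norm_sqr eE WeE/= => /le_trans; apply.
by rewrite ler_wpM2r ?lerDl// ltW ?mass_gt0.
Qed.

Let realM (a b : R) : (a * b)%:C = a%:C * b%:C.
Proof. exact: rmorphM. Qed.

Let real_sum (s : seq V) (F : V -> R) :
  (\sum_(x <- s) F x)%:C = \sum_(x <- s) (F x)%:C.
Proof. exact: rmorph_sum. Qed.

Let Re_sqrC (z : R[i]) : ((complex.Re `|z|) ^+ 2)%:C = `|z| ^+ 2.
Proof. by rewrite Re_norm_sqr add_Re2_Im2. Qed.

(** Cauchy-Schwarz on the fibre over v bounds |W*g(v)|^2 mu(v) by K times the integral of |g|^2 over
    that fibre; adding up the fibres bounds the whole norm. *)
Lemma wcomp_adj_bounded : bounded_operator mu wcomp_adj.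
Proof.
have [K K0 uK] := sum_children_weight_le.
have int_le g : (\int[mu]_x (complex.Re `|wcomp_adj g x| ^+ 2)%:E <=
    \int[mu]_x (K * complex.Re `|g x| ^+ 2)%:E)%E.
  apply: ge0_le_integral_fibres => //.
  - by move=> v; rewrite mulr_ge0 ?sqr_ge0// ltW.
  - by move=> v; rewrite sqr_ge0.
  move=> v; rewrite -lecR realM Re_sqrC real_sum wcomp_adjE.
  have -> : \sum_(x <- children v) (K * complex.Re `|g x| ^+ 2 * mass mu x)%:C =
      K%:C * \sum_(x <- children v) `|g x| ^+ 2 * p x.
    rewrite mulr_sumr; apply: eq_bigr => x _.
    by rewrite 2!realM Re_sqrC -mulrA.
  have p0 x : 0 < p x by rewrite ltcR mass_gt0.
  rewrite normrM normfV (gtr0_norm (p0 v)) exprMn.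
  (* One of the two divisions by the mass of v cancels against the weight of v. *)
  have -> (a : R[i]) : a * (p v)^-1 ^+ 2 * p v = a / p v.
    by rewrite expr2 mulrA mulfVK.
  (* The remaining division moves to the right, so the Cauchy-Schwarz constant is K mu(v), exactly
     the bound of [sum_children_weight_le]. *)
  rewrite ler_pdivrMr// mulrAC -realM.
  apply: weighted_Cauchy_Schwarz => [x||]; first exact/ltW.
    by rewrite ltcR mulr_gt0 ?mass_gt0.
  have := uK v; rewrite -lecR real_sum; apply: le_trans.
  rewrite le_eqVlt; apply/orP; left; apply/eqP; apply: eq_bigr => x _.
  by rewrite realM Re_sqrC.
have adjK g : L2 mu g -> (\int[mu]_x (K * complex.Re `|g x| ^+ 2)%:E =
    (K * L2norm mu g ^+ 2)%:E)%E.
  move=> Lg; have Ig := L2_integrable Lg.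
  rewrite (integralZl measurableT Ig K) L2norm_sqr EFinM fineK//.
  exact: integrable_fin_num Ig.
apply/bounded_operator_sqr; split.
- by move=> g Lg; apply/vertex_L2P/(le_lt_trans (int_le g)); rewrite adjK// ltry.
- move=> a f g _ _; apply/funext => v; rewrite !wcomp_adjE mulrA -mulrDl.
  congr (_ / _); rewrite mulr_sumr -big_split/=.
  by apply: eq_bigr => x _; ring.
- exists K => [|g Lg]; first exact: ltW.
  rewrite [leLHS]L2norm_sqr -lee_fin -adjK// fineK ?int_le//.
  rewrite ge0_fin_numE; last by apply: integral_ge0 => x _; rewrite lee_fin sqr_ge0.
  by apply: le_lt_trans (int_le g) _; rewrite adjK// ltry.
Qed.

(** Fibre by fibre: the integrand of <f, W*g> at v, times mu(v), is the weighted sum over the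
    children x of u(x) f(v) conj(g(x)), and f(v) = f(psi(x)). *)
Lemma wcomp_is_adjoint : is_adjoint mu (wcomp u) wcomp_adj.
Proof.
split=> [|f g Lf Lg]; first exact: wcomp_adj_bounded.
have [WL2 _ _] := W_bounded; have [BL2 _ _] := wcomp_adj_bounded.
apply/esym/eq_Cintegral_fibres => //.
- by apply: L2_mulC => //; exact: WL2.
- by apply: L2_mulC => //; exact: BL2.
move=> v; rewrite wcomp_adjE rmorphM/= fmorphV/= rmorph_sum/= -mulrA.
have pJ w : (p w)^* = p w by rewrite conj_Creal// complex_real.
rewrite pJ mulfVK// mulr_sumr big_seq [RHS]big_seq; apply: eq_bigr => x.
rewrite mem_children /wcomp => /eqP ->.
by rewrite !rmorphM/= conjCK pJ; ring.
Qed.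

End weighted_composition_adjoint.

(** * Both equivalences as instances of the pencil criterion *)

Theorem theorem4p1 (R : realType) (m : nat) (eta : 'I_m.+1 -> nat)
    (eta_neq0 : exists r, eta r <> 0%N)
    (mu : {measure set (vertex eta) -> \bar R})
    (mu_fin : forall v : vertex eta, (0 < mu [set v] < +oo)%E)
    (u : vertex eta -> R[i])
    (W_bounded : bounded_operator mu (wcomp u)) :
  (star_paranormal mu (wcomp u) <->
   forall lambda : R, 0 <= lambda ->
     positive_operator mu (fun f v =>
       ((RNderiv mu 2 v)%:C * condE_pull mu 2 (sqnormn u 2) v) * f v
       - 2 * lambda%:C * u v * (RNderiv mu 1 (parent v))%:C
           * condE mu 1 (fun w => (u w)^* * f w) v
       + lambda%:C ^+ 2 * f v))
  /\
  (quasi_star_paranormal mu (wcomp u) <->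
   forall lambda : R, 0 <= lambda ->
     positive_operator mu (fun f v =>
       ((RNderiv mu 3 v)%:C * condE_pull mu 3 (sqnormn u 3) v
        - 2 * lambda%:C *
            ((RNderiv mu 1 v)%:C
              * condE_pull mu 1 (fun w => `|u w| ^+ 2) v) ^+ 2
        + lambda%:C ^+ 2 *
            ((RNderiv mu 1 v)%:C
              * condE_pull mu 1 (fun w => `|u w| ^+ 2) v))
       * f v)).
Proof.
set W := wcomp u; pose B := wcomp_adj mu u.
have WB : is_adjoint mu W B := wcomp_is_adjoint mu_fin W_bounded.
have bB : bounded_operator mu B by case: WB.
have BW : is_adjoint mu B W := is_adjoint_sym W_bounded WB.
have [WL2 _ _] := W_bounded.
split.
- have bWW := bounded_operator_comp W_bounded W_bounded.
  have := positive_operator_pencilP bWW bB (bounded_operator_id mu)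
    (is_adjoint_comp W_bounded WB WB) BW (is_adjoint_id mu).
  have E l f v : (B \o B) ((W \o W) f) v - 2 * l%:C * W (B f) v +
        l%:C ^+ 2 * id (id f) v =
      ((RNderiv mu 2 v)%:C * condE_pull mu 2 (sqnormn u 2) v) * f v
       - 2 * l%:C * u v * (RNderiv mu 1 (parent v))%:C
           * condE mu 1 (fun w => (u w)^* * f w) v
       + l%:C ^+ 2 * f v.
    congr (_ - _ + _); first exact: (iter_wcomp_adj_wcomp mu_fin u 2 f v).
    by rewrite [W _ _](wcomp_wcomp_adj mu u f v) !mulrA.
  move=> P; apply: iff_trans (iff_trans P _).
    (* The adjoint supplied by the definition may differ from [B], but the norms agree. *)
    split=> [[B' WB' H] f Lf|H]; last by exists B.
    by rewrite (is_adjoint_L2norm WB WB')//; exact: H.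
  split=> H l l0; apply: eq_positive_operator (H l l0) => f v; first exact: E.
  exact/esym/E.
- have bWW := bounded_operator_comp W_bounded W_bounded.
  (* Here Y = W*W is its own adjoint, obtained by composing W and W* as adjoints of each other. *)
  have := positive_operator_pencilP (bounded_operator_comp W_bounded bWW)
    (bounded_operator_comp bB W_bounded) W_bounded
    (is_adjoint_comp bWW WB (is_adjoint_comp W_bounded WB WB))
    (is_adjoint_comp W_bounded BW WB) WB.
  have E l f v : ((B \o B) \o B) ((W \o (W \o W)) f) v -
        2 * l%:C * (B \o W) ((B \o W) f) v + l%:C ^+ 2 * B (W f) v =
      ((RNderiv mu 3 v)%:C * condE_pull mu 3 (sqnormn u 3) v
        - 2 * l%:C * ((RNderiv mu 1 v)%:C
              * condE_pull mu 1 (fun w => `|u w| ^+ 2) v) ^+ 2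
        + l%:C ^+ 2 * ((RNderiv mu 1 v)%:C
              * condE_pull mu 1 (fun w => `|u w| ^+ 2) v)) * f v.
    have BWE g : B (W g) v = (RNderiv mu 1 v)%:C *
        condE_pull mu 1 (fun w => `|u w| ^+ 2) v * g v.
      exact: wcomp_adj_wcomp.
    rewrite [(_ \o _) ((_ \o _) _) v](iter_wcomp_adj_wcomp mu_fin u 3 f v).
    (* W*W is multiplication by a function, so applying it twice in Y*Y produces the square of that
       function. *)
    rewrite [(_ \o _) ((_ \o _) _) v]BWE [(_ \o _) _ v]BWE BWE.
    ring.
  move=> P; apply: iff_trans (iff_trans P _).
    split=> [[B' WB' H] f Lf|H]; last by exists B.
    by rewrite /= (is_adjoint_L2norm WB WB')//; [exact: H|exact: WL2].
  split=> H l l0; apply: eq_positive_operator (H l l0) => f v; first exact: E.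
  exact/esym/E.
Qed.
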